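(* For every formula $A$ of $\mathcal{L}(\forall,\Box)$: if there exist a universal structure $\mathcal{A}$, a valuation $v$ on $\mathcal{A}$ and a world $w$ of $\mathcal{A}$ such that $\mathcal{A},v,w\models\Box A$, then $A\in\mathsf{FOL\Box}$.
   Context: Language $\mathcal{L}(\forall,\Box)$: first-order language with identity $=$, predicate symbols $P^n_j$, variables, no constants or function symbols, connectives $\neg,\to$, quantifier $\forall$, modal operator $\Box$ (arbitrary nesting); $\Diamond:=\neg\Box\neg$. A formula is $\Box$-free if it contains no $\Box$. $\mathsf{FOL}$ is the set of $\Box$-free theses of classical first-order logic with identity. Semantics: a structure is $\mathcal{A}=\langle \mathcal{W},\{\mathcal{D}_w\}_{w\in\mathcal{W}}, I\rangle$ with $\mathcal{W}\neq\emptyset$, nonempty domains $\mathcal{D}_w$, $I(P^n_j,w)\subseteq \mathcal{D}_w^n$. A valuation $v$ has $v(x,w)\in\mathcal{D}_w$; $v^a_x(w)$ agrees with $v$ except it sends $x$ at $w$ to $a\in\mathcal{D}_w$. $\mathcal{A},v,w\models P^n_j(x_1,\dots,x_n)$ iff $\langle v(x_1,w),\dots,v(x_n,w)\rangle\in I(P^n_j,w)$; $x=y$ iff $v(x,w)=v(y,w)$; $\neg,\to$ classical; $\forall xA$ iff $\mathcal{A},v^a_x(w),w\models A$ for all $a\in\mathcal{D}_w$; $\Box A$ iff $\mathcal{A},v',w'\models A$ for every valuation $v'$ and every world $w'$. $\mathcal{A}\models A$ means satisfaction at all $v,w$. With $\mathfrak{C}$ the class of all such structures, $\mathcal{A}\in\mathfrak{C}$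 is universal if for every $\Box$-free $A$, $\mathcal{A}\models A$ implies $\mathcal{B}\models A$ for all $\mathcal{B}\in\mathfrak{C}$. An occurrence of $x$ in $A$ is $\forall\Box$-bound if it is in the scope of a quantifier on $x$ or inside the scope of some $\Box$; otherwise $\forall\Box$-free. $x$ is a $\forall\Box$-free variable of $A$ if it has a $\forall\Box$-free occurrence. $A(^y/_x)$ is the simultaneous replacement of every $\forall\Box$-free occurrence of $x$ by $y$, provided $y$ is not captured by a quantifier. $\mathsf{FOL\Box}$ is the smallest set of formulas containing all instances of propositional tautologies and all instances of: $\Box(A\to B)\to(\Box A\to\Box B)$; $\Box A\to A$; $\neg\Box A\to\Box\neg\Box A$; $\forall xA\to A(^y/_x)$ (admissible $\forall\Box$-free substitution); $\forall x(A\to B)\to(A\to\forall xB)$ if $x$ is not $\forall\Box$-free in $A$; $x=x$; $x=y\wedge A(x)\to A(y)$ for $\Box$-free $A$ (usual first-order identity axiom); $\Box A\to\forall xA$; $\neg\Box A$ for every $\Box$-free $A\notin\mathsf{FOL}$; closed under: $A\in\mathsf{FOL\Box}\Rightarrow\Box A\in\mathsf{FOL\Box}$, and modus ponens. *)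

(* Defs.v *)
From mathcomp Require Import all_boot.
From mathcomp Require Import boolp.

Set Implicit Arguments.
Unset Strict Implicit.
Unset Printing Implicit Defensive.

Definition var := nat.

(* [Pred n j xs] is P^n_j(x_1, ..., x_n); there are countably many predicate
   symbols of each arity, arity 0 included. *)
Inductive form : Type :=
  | Pred (n j : nat) (xs : n.-tuple var)
  | Eq (x y : var)
  | Neg (A : form)
  | Imp (A B : form)
  | All (x : var) (A : form)
  | Box (A : form).

Definition And (A B : form) : form := Neg (Imp A (Neg B)).

Fixpoint box_free (A : form) : bool :=
  match A with
  | Pred _ _ _ | Eq _ _ => true
  | Neg B => box_free B
  | Imp B C => box_free B && box_free C
  | All _ B => box_free B
  | Box _ => false
  end.

(* x has an occurrence in A that is neither in the scope of a quantifier on x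
   nor inside the scope of a box. *)
Fixpoint ab_free (x : var) (A : form) : bool :=
  match A with
  | Pred _ _ xs => x \in (xs : seq var)
  | Eq y z => (x == y) || (x == z)
  | Neg B => ab_free x B
  | Imp B C => ab_free x B || ab_free x C
  | All z B => (x != z) && ab_free x B
  | Box _ => false
  end.

Definition subst_var (x y z : var) : var := if z == x then y else z.

(* [subst x y A] is A(^y/_x): occurrences under a quantifier on x or inside a
   box are left untouched. *)
Fixpoint subst (x y : var) (A : form) : form :=
  match A with
  | Pred n j xs => Pred j (map_tuple (subst_var x y) xs)
  | Eq z u => Eq (subst_var x y z) (subst_var x y u)
  | Neg B => Neg (subst x y B)
  | Imp B C => Imp (subst x y B) (subst x y C)
  | All z B => All z (if z == x then B else subst x y B)
  | Box B => Box B
  end.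

(* No occurrence of x in A that [subst x y A] replaces lies in the scope of a
   quantifier on y. *)
Fixpoint admissible (x y : var) (A : form) : bool :=
  match A with
  | Pred _ _ _ | Eq _ _ | Box _ => true
  | Neg B => admissible x y B
  | Imp B C => admissible x y B && admissible x y C
  | All z B => ~~ ab_free x (All z B) || (z != y) && admissible x y B
  end.

Inductive pform : Type :=
  | PVar (i : nat)
  | PNeg (p : pform)
  | PImp (p q : pform).

Fixpoint peval (e : nat -> bool) (p : pform) : bool :=
  match p with
  | PVar i => e i
  | PNeg q => ~~ peval e q
  | PImp q r => peval e q ==> peval e r
  end.

Definition tautology (p : pform) : Prop := forall e, peval e p.

Fixpoint pinst (s : nat -> form) (p : pform) : form :=
  match p with
  | PVar i => s i
  | PNeg q => Neg (pinst s q)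
  | PImp q r => Imp (pinst s q) (pinst s r)
  end.

(* Theses of a Hilbert calculus for classical first-order logic with identity
   on the box-free fragment; there [subst], [ab_free] and [admissible] are the
   usual first-order notions. *)
Inductive FOL : form -> Prop :=
  | FOL_taut p s : tautology p -> box_free (pinst s p) -> FOL (pinst s p)
  | FOL_inst x y A : box_free A -> admissible x y A ->
      FOL (Imp (All x A) (subst x y A))
  | FOL_dist x A B : box_free A -> box_free B -> ~~ ab_free x A ->
      FOL (Imp (All x (Imp A B)) (Imp A (All x B)))
  | FOL_refl x : FOL (Eq x x)
  | FOL_leibniz x y A : box_free A -> admissible x y A ->
      FOL (Imp (And (Eq x y) A) (subst x y A))
  | FOL_mp A B : FOL A -> FOL (Imp A B) -> FOL B
  | FOL_gen x A : FOL A -> FOL (All x A).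

Inductive FOLBox : form -> Prop :=
  | FOLBox_taut p s : tautology p -> FOLBox (pinst s p)
  | FOLBox_K A B : FOLBox (Imp (Box (Imp A B)) (Imp (Box A) (Box B)))
  | FOLBox_T A : FOLBox (Imp (Box A) A)
  | FOLBox_5 A : FOLBox (Imp (Neg (Box A)) (Box (Neg (Box A))))
  | FOLBox_inst x y A : admissible x y A ->
      FOLBox (Imp (All x A) (subst x y A))
  | FOLBox_dist x A B : ~~ ab_free x A ->
      FOLBox (Imp (All x (Imp A B)) (Imp A (All x B)))
  | FOLBox_refl x : FOLBox (Eq x x)
  | FOLBox_leibniz x y A : box_free A -> admissible x y A ->
      FOLBox (Imp (And (Eq x y) A) (subst x y A))
  | FOLBox_all x A : FOLBox (Imp (Box A) (All x A))
  | FOLBox_nonthesis A : box_free A -> ~ FOL A -> FOLBox (Neg (Box A))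
  | FOLBox_nec A : FOLBox A -> FOLBox (Box A)
  | FOLBox_mp A B : FOLBox A -> FOLBox (Imp A B) -> FOLBox B.

Record structure : Type := Structure {
  world : Type;
  world_inh : inhabited world;
  dom : world -> Type;
  dom_inh : forall w, inhabited (dom w);
  interp : forall (n j : nat) (w : world), n.-tuple (dom w) -> Prop
}.

Definition valuation (M : structure) : Type := var -> forall w : world M, dom w.

(* v^a_x(w): at worlds other than w, the value of x is unchanged too. *)
Definition update (M : structure) (v : valuation M) (x : var) (w : world M)
    (a : dom w) : valuation M :=
  fun y u =>
    match pselect (w = u) with
    | left e => if y == x then eq_rect w (@dom M) a u e else v y u
    | right _ => v y u
    end.

Fixpoint sat (M : structure) (v : valuation M) (w : world M) (A : form) : Prop :=
  match A with
  | Pred n j xs => interp j (map_tuple (fun x => v x w) xs)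
  | Eq x y => v x w = v y w
  | Neg B => ~ sat v w B
  | Imp B C => sat v w B -> sat v w C
  | All x B => forall a : dom w, sat (update v x a) w B
  | Box B => forall (v' : valuation M) (w' : world M), sat v' w' B
  end.

Definition models (M : structure) (A : form) : Prop :=
  forall (v : valuation M) (w : world M), sat v w A.

Definition universal (M : structure) : Prop :=
  forall A, box_free A -> models M A -> forall N : structure, models N A.

(* Main.v *)
(** In a universal structure a box-free formula holds everywhere iff it is a
    thesis of [FOL]; this is soundness and Gödel completeness.  In [FOLBox] a box
    over a box-free formula is provable or refutable according to the same
    criterion.  Hence, working outwards from the innermost boxes, every formula
    [A] can be replaced by a box-free [unbox A] which is equivalent to it both in
    [FOLBox] and in every universal structure, and the theorem reduces to
    completeness for [unbox A].

    Completeness is proved by a Henkin construction with variables as witnesses.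
    No renaming of bound variables is needed: every class of the canonical model
    contains variables foreign to any given formula [B], because a witness of
    [~ forall z, (B -> B) -> z <> y] avoids [B]. *)

From mathcomp Require Import all_boot.
From mathcomp Require Import boolp.
Require Import Defs.

Set Implicit Arguments.
Unset Strict Implicit.
Unset Printing Implicit Defensive.

(** * Syntax *)

(** Bound variables count too, so a variable at or above this bound is neither free in the formula
    nor captured when substituted into it. *)
Fixpoint var_bound (A : form) : nat :=
  match A with
  | Pred _ _ xs => (\max_(x <- xs) x).+1
  | Eq x y => (maxn x y).+1
  | Neg B => var_bound B
  | Imp B C => maxn (var_bound B) (var_bound C)
  | All z B => maxn z.+1 (var_bound B)
  | Box B => var_bound B
  end.

Lemma box_free_subst x y A : box_free (subst x y A) = box_free A.
Proof. by elim: A => //= [B -> C -> //|z B IH]; case: ifP. Qed.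

Lemma FOL_box_free A : FOL A -> box_free A.
Proof.
elim=> //= {A}.
- by move=> x y A bA _; rewrite box_free_subst bA.
- by move=> x A B -> ->.
- by move=> x y A bA _; rewrite box_free_subst bA.
- by move=> A B _ _ _ /andP[].
Qed.

Lemma leq_bigmax_mem (s : seq nat) x : x \in s -> x <= \max_(y <- s) y.
Proof. by move=> xs; apply: (leq_bigmax_seq (F := id)). Qed.

Lemma var_bound_not_free y A : var_bound A <= y -> ~~ ab_free y A.
Proof.
elim: A => //= [n j xs|u v|B IHB C IHC|z B IHB].
- move=> le; apply/negP => yin.
  by have := leq_trans le (leq_bigmax_mem yin); rewrite ltnn.
- rewrite gtn_max => /andP[lu lv].
  by rewrite (gtn_eqF lu) (gtn_eqF lv).
- by rewrite geq_max negb_or => /andP[/IHB -> /IHC ->].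
- by rewrite geq_max => /andP[_ /IHB /negbTE ->]; rewrite andbF.
Qed.

Lemma admissible_not_free x y A : ~~ ab_free x A -> admissible x y A.
Proof.
elim: A => //= [B IHB C IHC|z B IHB]; last by move->.
by rewrite negb_or => /andP[/IHB -> /IHC ->].
Qed.

Lemma admissible_fresh x y A : var_bound A <= y -> admissible x y A.
Proof.
elim: A => //= [B IHB C IHC|z B IHB].
- by rewrite geq_max => /andP[/IHB -> /IHC ->].
- by rewrite geq_max => /andP[lz /IHB ->]; rewrite (ltn_eqF lz) orbT.
Qed.

Lemma admissible_id x A : admissible x x A.
Proof.
elim: A => //= [B -> C -> //|z B ->].
by rewrite andbT negb_and negbK eq_sym; case: (z == x); rewrite ?orbT.
Qed.

Lemma subst_var_id x z : subst_var x x z = z.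
Proof. by rewrite /subst_var; case: eqP. Qed.

Lemma subst_id x A : subst x x A = A.
Proof.
elim: A => //= [n j xs|u v|B ->|B -> C ->|z B ->] //.
- congr Pred; apply: val_inj => /=.
  by rewrite (eq_map (subst_var_id x)) map_id.
- by rewrite !subst_var_id.
- by case: ifP.
Qed.

Lemma subst_not_free x y A : ~~ ab_free x A -> subst x y A = A.
Proof.
elim: A => //= [n j xs|u v|B IH|B IHB C IHC|z B IH].
- move=> nx; congr Pred; apply: val_inj => /=.
  rewrite -[RHS]map_id; apply/eq_in_map => z zin; rewrite /subst_var.
  by case: eqP => // e; rewrite -e zin in nx.
- rewrite negb_or eq_sym [x == v]eq_sym => /andP[/negbTE nu /negbTE nv].
  by rewrite /subst_var nu nv.
- by move/IH->.
- by rewrite negb_or => /andP[/IHB -> /IHC ->].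
- rewrite negb_and negbK eq_sym; case: ifP => //= _ /IH -> //.
Qed.

(** Together with [admissible_substK], this lets a universal closure over a fresh y be turned back
    into one over x. *)
Lemma substK_fresh x y A : var_bound A <= y -> subst y x (subst x y A) = A.
Proof.
elim: A => //= [n j xs|u v|B IH|B IHB C IHC|z B IH].
- move=> le; congr Pred; apply: val_inj => /=.
  rewrite -map_comp -[RHS]map_id; apply/eq_in_map => z zin.
  have zy: z < y by apply: leq_ltn_trans (leq_bigmax_mem zin) le.
  rewrite /= /subst_var; case: (z =P x) => [->|_]; first by rewrite eqxx.
  by rewrite (ltn_eqF zy).
- rewrite gtn_max /subst_var => /andP[lu lv].
  by congr Eq; [case: (u =P x) => [->|_]|case: (v =P x) => [->|_]];
    rewrite ?eqxx // ?(ltn_eqF lu) ?(ltn_eqF lv).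
- by move/IH->.
- by rewrite geq_max => /andP[/IHB -> /IHC ->].
- rewrite geq_max => /andP[lz lB]; rewrite (ltn_eqF lz).
  case: (z =P x) => _; last by rewrite IH.
  by rewrite subst_not_free ?var_bound_not_free.
Qed.

Lemma admissible_substK x y A :
  var_bound A <= y -> admissible y x (subst x y A).
Proof.
elim: A => //= [B IHB C IHC|z B IH].
- by rewrite geq_max => /andP[/IHB -> /IHC ->].
- rewrite geq_max => /andP[lz lB].
  case: (z =P x) => _; last by rewrite IH // orbT.
  by rewrite (negbTE (var_bound_not_free lB)) andbF.
Qed.

Lemma subst_not_ab_free x y A : x != y -> ~~ ab_free x (subst x y A).
Proof.
have xs z : x != y -> x != subst_var x y z.
  by rewrite /subst_var; case: (z =P x) => // /eqP; rewrite eq_sym.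
move=> xy; elim: A => //= [n j t|u v|B IHB C IHC|z B IH].
- by apply/negP => /mapP[z _ e]; move: (xs z xy); rewrite -e eqxx.
- by rewrite negb_or !xs.
- by rewrite negb_or IHB.
- by rewrite negb_and negbK eq_sym; case: (z == x).
Qed.

(** Measure for the truth lemma, whose quantifier case appeals to a substitution instance of the
    body instead of the body itself. *)
Fixpoint form_size (A : form) : nat :=
  match A with
  | Pred _ _ _ | Eq _ _ => 0
  | Neg B | All _ B | Box B => (form_size B).+1
  | Imp B C => (form_size B + form_size C).+1
  end.

Lemma form_size_subst x y A : form_size (subst x y A) = form_size A.
Proof. by elim: A => //= [B -> //|B -> C -> //|z B IH]; case: ifP; rewrite ?IH. Qed.

(** * Coding of formulas by natural numbers *)

Fixpoint form_tree (A : form) : GenTree.tree nat :=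
  match A with
  | Pred n j xs => GenTree.Node 0
      (GenTree.Leaf n :: GenTree.Leaf j :: [seq GenTree.Leaf x | x <- xs])
  | Eq x y => GenTree.Node 1 [:: GenTree.Leaf x; GenTree.Leaf y]
  | Neg B => GenTree.Node 2 [:: form_tree B]
  | Imp B C => GenTree.Node 3 [:: form_tree B; form_tree C]
  | All x B => GenTree.Node 4 [:: GenTree.Leaf x; form_tree B]
  | Box B => GenTree.Node 5 [:: form_tree B]
  end.

Lemma form_tree_inj : injective form_tree.
Proof.
elim=> [n j xs|x y|B IH|B IHB C IHC|x B IH|B IH] [n' j' xs'|x' y'|B'|B' C'|x' B'|B'] //=.
- case=> en ej e; subst n' j'; congr Pred; apply: val_inj => /=.
  by apply: inj_map e => a b [].
- by case=> -> ->.
- by case=> /IH ->.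
- by case=> /IHB -> /IHC ->.
- by case=> -> /IH ->.
- by case=> /IH ->.
Qed.

Definition form_code (A : form) : nat := pickle (form_tree A).

Lemma form_code_inj : injective form_code.
Proof. by move=> A B /(pcan_inj pickleK) /form_tree_inj. Qed.

Definition form_decode (n : nat) : form :=
  if pselect (exists A, form_code A = n) is left ex then projT1 (cid ex)
  else Eq 0 0.

Lemma form_codeK : cancel form_code form_decode.
Proof.
move=> A; rewrite /form_decode; case: pselect => [ex|[]]; last by exists A.
by case: cid => B /= /form_code_inj.
Qed.

(** * Propositional reasoning *)

(* Maximal subformulas that are not a negation or an implication become
   propositional variables, so a concrete propositional schema is proved by
   computing [peval] and case analysis on its metavariables. *)
Fixpoint skeleton (A : form) : pform :=
  match A with
  | Neg B => PNeg (skeleton B)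
  | Imp B C => PImp (skeleton B) (skeleton C)
  | _ => PVar (form_code A)
  end.

Lemma pinst_skeleton A : pinst form_decode (skeleton A) = A.
Proof. by elim: A => /= *; rewrite ?form_codeK //; congruence. Qed.

Lemma FOL_skeleton A : box_free A -> tautology (skeleton A) -> FOL A.
Proof.
by move=> bA tA; rewrite -(pinst_skeleton A); apply: FOL_taut; rewrite ?pinst_skeleton.
Qed.

Lemma FOLBox_skeleton A : tautology (skeleton A) -> FOLBox A.
Proof. by move=> tA; rewrite -(pinst_skeleton A); apply: FOLBox_taut. Qed.

Ltac box_free_tac :=
  rewrite /= ?box_free_subst;
  repeat match goal with
  | H : is_true (box_free ?A) |- context [box_free ?A] => rewrite H
  end; done.

Ltac taut_tac :=
  let e := fresh "e" in move=> e /=;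
  repeat match goal with
  | |- context [peval e ?p] => generalize (peval e p); case
  | |- context [e ?i] => generalize (e i); case
  end; done.

Ltac fol_taut := apply: FOL_skeleton; [box_free_tac | taut_tac].
Ltac folbox_taut := apply: FOLBox_skeleton; taut_tac.

Lemma FOL_trans A B C : FOL (Imp A B) -> FOL (Imp B C) -> FOL (Imp A C).
Proof.
move=> AB BC; have /= /andP[bA bB] := FOL_box_free AB.
have /= /andP[_ bC] := FOL_box_free BC.
apply: (FOL_mp BC); apply: (FOL_mp AB); fol_taut.
Qed.

Lemma FOL_mp_imp A B C :
  FOL (Imp A B) -> FOL (Imp A (Imp B C)) -> FOL (Imp A C).
Proof.
move=> AB ABC; have /= /and3P[bA bB bC] := FOL_box_free ABC.
apply: (FOL_mp ABC); apply: (FOL_mp AB); fol_taut.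
Qed.

Lemma FOL_gen_imp x A B :
  ~~ ab_free x A -> FOL (Imp A B) -> FOL (Imp A (All x B)).
Proof.
move=> nx AB; have /= /andP[bA bB] := FOL_box_free AB.
by apply: FOL_mp (FOL_gen x AB) _; apply: FOL_dist.
Qed.

Lemma FOL_eq_sym x y : FOL (Imp (Eq x y) (Eq y x)).
Proof.
case: (x =P y) => [->|/eqP xy]; first by fol_taut.
(* [subst] replaces every free x, so Leibniz on x = x would only give y = y. The right-hand x is
   therefore kept as a fresh z, which is then generalised and instantiated to x. *)
have [z xz yz] : exists2 z, x < z & y < z.
  by exists (maxn x y).+1; rewrite ltnS ?leq_maxl ?leq_maxr.
have /(@FOL_gen z) H : FOL (Imp (And (Eq x y) (Eq x z)) (Eq y z)).
  have := @FOL_leibniz x y (Eq x z) isT isT.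
  by rewrite /= /subst_var eqxx (gtn_eqF xz).
have := @FOL_inst z x (Imp (And (Eq x y) (Eq x z)) (Eq y z)) isT isT.
rewrite /= /subst_var eqxx (ltn_eqF xz) (ltn_eqF yz) => /(FOL_mp H) H1.
apply: (FOL_mp H1); apply: (FOL_mp (FOL_refl x)); fol_taut.
Qed.

Lemma FOL_eq_trans x y z : FOL (Imp (Eq x y) (Imp (Eq y z) (Eq x z))).
Proof.
case: (z =P y) => [->|/eqP zy]; first by fol_taut.
(* With z distinct from y, only the left side of y = z gets replaced. *)
have := @FOL_leibniz y x (Eq y z) isT isT.
rewrite /= /subst_var eqxx (negbTE zy) => H.
apply: (FOL_mp H); apply: (FOL_mp (FOL_eq_sym x y)); fol_taut.
Qed.

(** * Soundness of [FOL] *)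

Lemma updateE (M : structure) (v : valuation M) x w (a : dom w) y :
  update v x a y w = if y == x then a else v y w.
Proof.
rewrite /update; case: pselect => [e|//].
by rewrite (Prop_irrelevance e erefl).
Qed.

(** The box clause quantifies over all valuations and worlds afresh, so only values at w of
    variables free outside every box can matter. *)
Lemma sat_ext (M : structure) (w : world M) A (v v' : valuation M) :
  (forall x, ab_free x A -> v x w = v' x w) -> sat v w A <-> sat v' w A.
Proof.
elim: A v v' => //= [n j xs|x y|B IH|B IHB C IHC|x B IH] v v' E.
- suff -> : map_tuple (fun x => v x w) xs = map_tuple (fun x => v' x w) xs by [].
  by apply: val_inj => /=; apply/eq_in_map.
- by rewrite !E ?eqxx ?orbT.
- by split=> nB sB; apply: nB; apply: (IH v v' E).2 || apply: (IH v v' E).1.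
- have /IHB {}IHB x : ab_free x B -> v x w = v' x w by move=> xB; rewrite E ?xB.
  have /IHC {}IHC x : ab_free x C -> v x w = v' x w by move=> xC; rewrite E ?xC ?orbT.
  tauto.
- have U (a : dom w) y : ab_free y B -> update v x a y w = update v' x a y w.
    by move=> yB; rewrite !updateE; case: eqP => // /eqP yx; rewrite E ?yx.
  by split=> H a; [apply/(IH _ _ (U a))|apply/(IH _ _ (U a))].
Qed.

Lemma sat_subst (M : structure) (w : world M) x y A (v : valuation M) :
  admissible x y A -> sat v w (subst x y A) <-> sat (update v x (v y w)) w A.
Proof.
have V (u : valuation M) z : u (subst_var x y z) w = update u x (u y w) z w.
  by rewrite updateE /subst_var; case: eqP.
elim: A v => //= [n j xs|z u|B IH|B IHB C IHC|z B IH] v.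
- move=> _; set s := map_tuple _ _; set t := map_tuple _ _.
  suff -> : s = t by [].
  by apply: val_inj; rewrite /= -map_comp; apply: eq_map => z /=.
- by rewrite !V.
- by move/(IH v)=> E; split=> nB sB; apply: nB; apply/E.
- by case/andP=> /(IHB v) EB /(IHC v) EC; tauto.
- have [/eqP zx _|zx] := boolP (z == x).
    subst z; suff E (a : dom w) : sat (update v x a) w B <->
        sat (update (update v x (v y w)) x a) w B.
      by split=> H a; apply/E.
    by apply: sat_ext => u _; rewrite !updateE; case: eqP.
  rewrite eq_sym zx /=; case: (boolP (ab_free x B)) => [_ /= /andP[zy adm]|nx _].
    suff E (a : dom w) : sat (update v z a) w (subst x y B) <->
        sat (update (update v x (v y w)) z a) w B.
      by split=> H a; apply/E.
    apply: iff_trans (IH _ adm) _; apply: sat_ext => u _.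
    rewrite !updateE [y == z]eq_sym (negbTE zy).
    by case: (u =P x) => // ->; rewrite eq_sym (negbTE zx).
  (* Here z may equal y, but x does not occur free in B, so nothing is substituted and nothing can
     be captured. *)
  rewrite subst_not_free //.
  suff E (a : dom w) : sat (update v z a) w B <->
      sat (update (update v x (v y w)) z a) w B.
    by split=> H a; apply/E.
  apply: sat_ext => u uB; rewrite !updateE; case: (u =P x) => // ux.
  by rewrite -ux uB in nx.
Qed.

Lemma sat_pinst (M : structure) (v : valuation M) w s p :
  sat v w (pinst s p) <-> peval (fun i => `[< sat v w (s i) >]) p.
Proof.
elim: p => [i|p IH|p IHp q IHq] /=; first by split=> /asboolP.
- by split=> [np|/negP np]; [apply/negP|]; move=> /IH.
- by split=> [pq|/implyP pq]; [apply/implyP => /IHp /pq /IHq|move=> /IHp /pq /IHq].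
Qed.

Theorem FOL_sound A : FOL A -> forall M, models M A.
Proof.
elim=> {A} [p s tp _|x y A _ adm|x A B _ _ nx|x|x y A _ adm|A B _ IHA _ IHAB|x A _ IH] M v w /=.
- exact/sat_pinst.
- by move=> H; apply/sat_subst.
- move=> H sA a; apply: H; apply/(sat_ext (v' := v)) => // y yA.
  by rewrite updateE; case: eqP => // yx; rewrite -yx yA in nx.
- by [].
- move=> H; apply/sat_subst => //.
  have [exy sA] : v x w = v y w /\ sat v w A.
    by split; apply: contrapT => n; apply: H.
  apply/(sat_ext (v' := v)) => // z _; rewrite updateE; case: eqP => // ->.
  by rewrite exy.
- exact: IHAB (IHA M v w).
- by move=> a; apply: IH.
Qed.

(** * Henkin theories *)

(** [henkin_neg] is consistency and maximality at once, on the box-free fragment. In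
    [henkin_witness] the variable y is a counterexample to [All x B] whenever that formula is not in
    D. *)
Record henkin_theory (D : form -> Prop) : Prop := HenkinTheory {
  henkin_FOL : forall B, FOL B -> D B;
  henkin_mp : forall B C, D B -> D (Imp B C) -> D C;
  henkin_neg : forall B, box_free B -> D (Neg B) <-> ~ D B;
  henkin_witness : forall x B, box_free B ->
    exists2 y, var_bound (All x B) <= y & D (subst x y B) -> D (All x B)
}.

(** * Lindenbaum completion with witnesses *)

Definition box_free_enum (n : nat) : form :=
  if box_free (form_decode n) then form_decode n else Eq 0 0.

Lemma box_free_box_free_enum n : box_free (box_free_enum n).
Proof. by rewrite /box_free_enum; case: ifP. Qed.

Lemma box_free_enum_surj B : box_free B -> exists n, box_free_enum n = B.
Proof. by move=> bB; exists (form_code B); rewrite /box_free_enum form_codeK bB. Qed.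

Definition decide (G B : form) : form :=
  if pselect (FOL (Neg (And G B))) then And G (Neg B) else And G B.

Definition add_witness (G B : form) : form :=
  if B is All x C then
    And G (Imp (subst x (maxn (var_bound G) (var_bound B)) C) B)
  else G.

(** A stage is a single formula, so it uses finitely many variables and a fresh witness always
    exists. A universal formula receives its witness right after it is decided, whichever way that
    went. *)
Fixpoint stage (A : form) (n : nat) : form :=
  if n is m.+1 then
    add_witness (decide (stage A m) (box_free_enum m)) (box_free_enum m)
  else A.

Definition consistent (A : form) : Prop := box_free A /\ ~ FOL (Neg A).

Lemma consistent_decide G B :
  box_free B -> consistent G -> consistent (decide G B).
Proof.
move=> bB [bG cG]; rewrite /decide; case: pselect => [nGB|cGB]; last first.
  by split=> //; box_free_tac.
split=> [|nGnB]; first by box_free_tac.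
by apply: cG; apply: (FOL_mp nGnB); apply: (FOL_mp nGB); fol_taut.
Qed.

Lemma consistent_add_witness G B :
  box_free B -> consistent G -> consistent (add_witness G B).
Proof.
case: B => //= x B bB [bG cG]; set y := maxn _ _.
have [Gy] : var_bound G <= y /\ maxn x.+1 (var_bound B) <= y.
  by rewrite leq_maxl leq_maxr.
rewrite geq_max => /andP[xy By].
split=> [|incons]; first by box_free_tac.
(* A refuted witness conjunct makes G prove the y-instance and the negation of [All x B]. Since y is
   foreign to G, the instance can be generalised and renamed back to [All x B], so G is
   inconsistent. *)
have Gsub : FOL (Imp G (subst x y B)) by apply: (FOL_mp incons); fol_taut.
have GnA : FOL (Imp G (Neg (All x B))) by apply: (FOL_mp incons); fol_taut.
have back : FOL (Imp (All y (subst x y B)) (All x B)).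
  apply: FOL_gen_imp.
    by rewrite /= negb_and subst_not_ab_free ?orbT // (ltn_eqF xy).
  rewrite -{2}(substK_fresh x By).
  by apply: FOL_inst; rewrite ?box_free_subst // admissible_substK.
have GA := FOL_trans (FOL_gen_imp (var_bound_not_free Gy) Gsub) back.
by apply: cG; apply: (FOL_mp GnA); apply: (FOL_mp GA); fol_taut.
Qed.

Lemma consistent_stage A n : consistent A -> consistent (stage A n).
Proof.
move=> cA; elim: n => //= n IH.
have bn := box_free_box_free_enum n.
exact: consistent_add_witness (consistent_decide _ IH).
Qed.

Lemma FOL_decide G B : box_free G -> box_free B -> FOL (Imp (decide G B) G).
Proof. by move=> bG bB; rewrite /decide; case: pselect => ? /=; fol_taut. Qed.

Lemma FOL_decided G B : box_free G -> box_free B ->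
  FOL (Imp (decide G B) B) \/ FOL (Imp (decide G B) (Neg B)).
Proof.
by move=> bG bB; rewrite /decide; case: pselect => ? /=; [right|left]; fol_taut.
Qed.

Lemma FOL_add_witness G B :
  box_free G -> box_free B -> FOL (Imp (add_witness G B) G).
Proof. by case: B => [n j xs|x y|C|C E|x C|C] bG /= bC; fol_taut. Qed.

Lemma FOL_stage_decide A n : consistent A ->
  FOL (Imp (stage A n.+1) (decide (stage A n) (box_free_enum n))).
Proof.
move=> cA; have bn := box_free_box_free_enum n.
apply: FOL_add_witness => //.
by have [] := consistent_decide bn (consistent_stage n cA).
Qed.

Lemma FOL_stage_le A m n : consistent A -> m <= n ->
  FOL (Imp (stage A n) (stage A m)).
Proof.
move=> cA /subnK <-; elim: (n - m) => [|k IH].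
  by rewrite add0n; have [b _] := consistent_stage m cA; fol_taut.
have [b _] := consistent_stage (k + m) cA.
rewrite addSn; apply: FOL_trans IH; apply: FOL_trans (FOL_stage_decide _ cA) _.
by apply: FOL_decide; rewrite ?box_free_box_free_enum.
Qed.

Definition completion (A B : form) : Prop := exists n, FOL (Imp (stage A n) B).

Lemma completion_mp A B C : consistent A ->
  completion A B -> completion A (Imp B C) -> completion A C.
Proof.
move=> cA [m mB] [n nBC]; exists (maxn m n).
apply: (FOL_mp_imp (B := B)).
  exact: FOL_trans (FOL_stage_le cA (leq_maxl m n)) mB.
exact: FOL_trans (FOL_stage_le cA (leq_maxr m n)) nBC.
Qed.

Lemma completion_henkin A : consistent A -> henkin_theory (completion A).
Proof.
move=> cA; split.
- move=> B fB; exists 0; have [/= bA _] := cA.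
  by have bB := FOL_box_free fB; apply: (FOL_mp fB); fol_taut.
- by move=> B C; apply: completion_mp.
- move=> B bB; split=> [nB pB|nB].
    have [n nF] : completion A (Neg (Imp B B)).
      apply: (completion_mp cA pB); apply: (completion_mp cA nB).
      by exists 0; have [/= bA _] := cA; fol_taut.
    have [bn] := consistent_stage n cA; apply.
    by apply: (FOL_mp nF); fol_taut.
  have [n en] := box_free_enum_surj bB.
  have [bn _] := consistent_stage n cA.
  have := FOL_stage_decide n cA; rewrite en => H.
  have [pB|nB'] := FOL_decided bn bB.
    by case: nB; exists n.+1; apply: FOL_trans H pB.
  by exists n.+1; apply: FOL_trans H nB'.
- move=> x B bB; have [n en] := @box_free_enum_surj (All x B) bB.
  (* G is what stage n+1 extends by the witness conjunct, so the [maxn] below is the very variable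
     chosen by [add_witness]. *)
  pose G := decide (stage A n) (All x B).
  have [bG _] : consistent G.
    exact: consistent_decide (consistent_stage n cA).
  exists (maxn (var_bound G) (var_bound (All x B))); first exact: leq_maxr.
  move=> sB; apply: (completion_mp cA sB); exists n.+1.
  rewrite [stage A _.+1]/= en [add_witness _ _]/= -/G.
  by move: (maxn _ _) => y; fol_taut.
Qed.

(** * The canonical model *)

Lemma henkin_imp D B C : henkin_theory D -> box_free B -> box_free C ->
  D (Imp B C) <-> (D B -> D C).
Proof.
move=> hD bB bC; split=> [BC pB|BC]; first exact: henkin_mp hD _ _ pB BC.
have [pB|nB] := pselect (D B).
  by apply: henkin_mp hD _ _ (BC pB) (henkin_FOL hD _); fol_taut.
move/(henkin_neg hD bB): nB => nB.
by apply: henkin_mp hD _ _ nB (henkin_FOL hD _); fol_taut.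
Qed.

Lemma henkin_subst D x y A : henkin_theory D -> box_free A -> admissible x y A ->
  D (Eq x y) -> D A <-> D (subst x y A).
Proof.
move=> hD bA aA exy.
have E B : box_free B -> admissible x y B -> D B -> D (subst x y B).
  move=> bB aB pB; apply: (henkin_mp hD pB); apply: (henkin_mp hD exy).
  apply: (henkin_mp hD (henkin_FOL hD (FOL_leibniz bB aB))).
  by apply: (henkin_FOL hD); fol_taut.
split=> [|sA]; first exact: E.
(* Substituting y for x need not be reversible, so the converse comes from the forward direction
   applied to [Neg A]. *)
apply: contrapT => /(henkin_neg hD bA) /(E (Neg A) bA aA) /=.
by move/(henkin_neg hD); rewrite box_free_subst => /(_ bA).
Qed.

Lemma henkin_eq_ex D x : henkin_theory D -> exists y, `[< D (Eq x y) >].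
Proof. by move=> hD; exists x; apply/asboolP; apply: henkin_FOL hD _ (FOL_refl x). Qed.

(** Least variable of the class of x under provable equality; representatives stand in for a
    quotient type. *)
Definition eq_repr D (hD : henkin_theory D) (x : var) : var :=
  ex_minn (henkin_eq_ex x hD).

Lemma eq_reprP D (hD : henkin_theory D) x : D (Eq x (eq_repr hD x)).
Proof. by rewrite /eq_repr; case: ex_minnP => y /asboolP. Qed.

Lemma eq_repr_le D (hD : henkin_theory D) x : eq_repr hD x <= x.
Proof.
rewrite /eq_repr; case: ex_minnP => y _; apply.
by apply/asboolP; apply: henkin_FOL hD _ (FOL_refl x).
Qed.

Lemma eq_repr_eq D (hD : henkin_theory D) x y :
  eq_repr hD x = eq_repr hD y <-> D (Eq x y).
Proof.
have sym u v : D (Eq u v) -> D (Eq v u).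
  by move=> e; apply: henkin_mp hD _ _ e (henkin_FOL hD (FOL_eq_sym u v)).
have trans u v t : D (Eq u v) -> D (Eq v t) -> D (Eq u t).
  move=> e f; apply: (henkin_mp hD f); apply: (henkin_mp hD e).
  exact: henkin_FOL hD _ (FOL_eq_trans u v t).
split=> [e|e].
  by apply: trans (eq_reprP hD x) _; rewrite e; apply: sym (eq_reprP hD y).
rewrite /eq_repr; apply: eq_ex_minn => z.
by apply: asbool_equiv_eq; split=> f; [apply: trans (sym _ _ e) f|apply: trans e f].
Qed.

Lemma eq_repr_id D (hD : henkin_theory D) x :
  eq_repr hD (eq_repr hD x) == eq_repr hD x.
Proof. by apply/eqP/esym/eq_repr_eq; apply: eq_reprP. Qed.

(* Variables are replaced by their representatives in increasing order: since
   [eq_repr x <= x], a representative is never replaced again. *)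
Lemma henkin_Pred_repr D (hD : henkin_theory D) n j (xs : n.-tuple var) :
  D (Pred j xs) <-> D (Pred j (map_tuple (eq_repr hD) xs)).
Proof.
pose f k z := if z < k then eq_repr hD z else z.
have step k : D (Pred j xs) <-> D (Pred j (map_tuple (f k) xs)).
  elim: k => [|k IH].
    suff -> : map_tuple (f 0) xs = xs by [].
    by apply: val_inj; rewrite /= map_id.
  apply: (iff_trans IH).
  apply: (iff_trans (henkin_subst hD _ _ (eq_reprP hD k))) => //=.
  suff -> : map_tuple (subst_var k (eq_repr hD k)) (map_tuple (f k) xs)
            = map_tuple (f k.+1) xs by [].
  apply: val_inj; rewrite /= -map_comp; apply: eq_map => z /=.
  rewrite /f /subst_var ltnS; case: (ltngtP z k) => [zk|kz|->].
  - by rewrite (ltn_eqF (leq_ltn_trans (eq_repr_le hD z) zk)).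
  - by rewrite (gtn_eqF kz).
  - by rewrite eqxx.
apply: (iff_trans (step (var_bound (Pred j xs)))).
set s := map_tuple _ _; set t := map_tuple _ _; suff -> : s = t by [].
apply: val_inj; apply/eq_in_map => z zin.
by rewrite /f ltnS (leq_bigmax_mem zin).
Qed.

Lemma henkin_fresh_eq D (hD : henkin_theory D) B y : box_free B ->
  exists2 z, var_bound B <= z & eq_repr hD z = eq_repr hD y.
Proof.
move=> bB; have [z yz Bz] : exists2 z, y < z & var_bound B <= z.
  by exists (maxn y.+1 (var_bound B)); rewrite ?leq_maxl ?leq_maxr.
(* C says z <> y; the tautology [Imp B B] only forces its witness u above [var_bound B]. If u = y
   were not in D, then [All z C] would be, and its instance at y refutes y = y. *)
pose C := Imp (Imp B B) (Neg (Eq z y)).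
have bC : box_free C by box_free_tac.
have [u] := henkin_witness hD z bC.
rewrite /= !geq_max => /and3P[zu /andP[Bu _] _] wit.
exists u => //; apply/eq_repr_eq; apply: contrapT => neq.
have {wit} allC : D (All z C).
  apply: wit; rewrite /subst_var eqxx (ltn_eqF yz).
  have nu : D (Neg (Eq u y)) by apply/(henkin_neg hD).
  by apply: (henkin_mp hD nu); apply: (henkin_FOL hD); fol_taut.
have adm : admissible z y C.
  by rewrite /= andbT !admissible_not_free ?var_bound_not_free.
have := henkin_mp hD allC (henkin_FOL hD (FOL_inst bC adm)).
rewrite /= /subst_var eqxx (ltn_eqF yz) => H.
have : D (Neg (Eq y y)).
  by apply: (henkin_mp hD H); apply: (henkin_FOL hD); fol_taut.
by move/(henkin_neg hD); apply=> //; apply: henkin_FOL hD _ (FOL_refl y).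
Qed.

Definition canonical_dom D (hD : henkin_theory D) : Type :=
  {x : var | eq_repr hD x == x}.

Definition class_of D (hD : henkin_theory D) (x : var) : canonical_dom hD :=
  exist _ (eq_repr hD x) (eq_repr_id hD x).

(** One world suffices because the model only has to evaluate box-free formulas. *)
Definition canonical D (hD : henkin_theory D) : structure :=
  @Structure unit (inhabits tt) (fun=> canonical_dom hD)
    (fun=> inhabits (class_of hD 0))
    (fun n j _ t => D (Pred j (map_tuple (fun a : canonical_dom hD => val a) t))).

Definition canonical_val D (hD : henkin_theory D) : valuation (canonical hD) :=
  fun x _ => class_of hD x.
Arguments canonical_val {D} hD _ _.

Lemma class_of_val D (hD : henkin_theory D) (a : canonical_dom hD) :
  class_of hD (val a) = a.
Proof. by apply: val_inj; apply/eqP/(valP a). Qed.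

Lemma truth_lemma D (hD : henkin_theory D) A : box_free A ->
  sat (canonical_val hD) (tt : world (canonical hD)) A <-> D A.
Proof.
have [m] := ubnP (form_size A); elim: m A => // m IH.
case=> [n j xs|x y|B|B C|x B|//] /= szA bA.
- apply: iff_sym; apply: (iff_trans (henkin_Pred_repr hD j xs)).
  set s := map_tuple _ _; set t := map_tuple _ _; suff -> : s = t by [].
  by apply: val_inj; rewrite /= -map_comp.
- rewrite -(eq_repr_eq hD); split=> [[]//|e].
  exact: val_inj.
- rewrite (henkin_neg hD bA); have := IH B szA bA; tauto.
- case/andP: bA => bB bC; rewrite (henkin_imp hD bB bC).
  have EB := IH B (leq_ltn_trans (leq_addr _ _) szA) bB.
  have EC := IH C (leq_ltn_trans (leq_addl _ _) szA) bC.
  tauto.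
- have sub y : var_bound B <= y ->
      sat (update (canonical_val hD) x (canonical_val hD y tt)) tt B
      <-> D (subst x y B).
    move=> By; rewrite -IH ?form_size_subst ?box_free_subst //.
    by apply: iff_sym; apply: sat_subst; apply: admissible_fresh.
  split=> [H|H a].
    have [y] := henkin_witness hD x bA.
    by rewrite geq_max => /andP[_ By]; apply; apply/sub.
  (* The representative of a might be captured in B; another member of its class, foreign to B, is
     substituted instead. *)
  have [y By e] := henkin_fresh_eq hD (val a) bA.
  have -> : a = canonical_val hD y tt.
    by rewrite -[LHS]class_of_val; apply: val_inj.
  apply/(sub _ By); apply: (henkin_mp hD H); apply: (henkin_FOL hD).
  by apply: FOL_inst => //; apply: admissible_fresh.
Qed.

Theorem FOL_complete A : box_free A -> (forall M, models M A) -> FOL A.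
Proof.
move=> bA valid; apply: contrapT => nA.
have cA : consistent (Neg A).
  by split=> // nnA; apply: nA; apply: (FOL_mp nnA); fol_taut.
have hD := completion_henkin cA.
have /(henkin_neg hD bA) : completion (Neg A) (Neg A) by exists 0; fol_taut.
by apply; apply/(truth_lemma hD bA); apply: valid.
Qed.

(** * Elimination of boxes *)

(** [Eq 0 0] and its negation serve as the constants true and false; excluded middle selects between
    them. *)
Fixpoint unbox (A : form) : form :=
  match A with
  | Pred _ _ _ | Eq _ _ => A
  | Neg B => Neg (unbox B)
  | Imp B C => Imp (unbox B) (unbox C)
  | All x B => All x (unbox B)
  | Box B => if pselect (FOL (unbox B)) then Eq 0 0 else Neg (Eq 0 0)
  end.

Lemma box_free_unbox A : box_free (unbox A).
Proof. by elim: A => //= [B -> C -> //|B _]; case: pselect. Qed.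

(** Generalisation is not a rule of [FOLBox]; it is recovered from necessitation and the axiom
    [Box A] implies [All x A]. *)
Lemma FOLBox_gen x A : FOLBox A -> FOLBox (All x A).
Proof. by move/FOLBox_nec/FOLBox_mp; apply; apply: FOLBox_all. Qed.

Lemma FOL_FOLBox A : FOL A -> FOLBox A.
Proof.
elim=> {A} [p s tp _|x y A _ adm|x A B _ _ nx|x|x y A bA adm|A B _ pA _ pAB|x A _ pA].
- exact: FOLBox_taut.
- exact: FOLBox_inst.
- exact: FOLBox_dist.
- exact: FOLBox_refl.
- exact: FOLBox_leibniz.
- exact: FOLBox_mp pA pAB.
- exact: FOLBox_gen.
Qed.

Lemma FOLBox_trans A B C :
  FOLBox (Imp A B) -> FOLBox (Imp B C) -> FOLBox (Imp A C).
Proof.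
by move=> AB BC; apply: (FOLBox_mp BC); apply: (FOLBox_mp AB); folbox_taut.
Qed.

Lemma FOLBox_const A B : FOLBox B -> FOLBox (Imp A B).
Proof. by move=> pB; apply: (FOLBox_mp pB); folbox_taut. Qed.

Lemma FOLBox_all_mono x A B : FOLBox (Imp A B) -> FOLBox (Imp (All x A) (All x B)).
Proof.
move=> AB; have H : FOLBox (Imp (All x A) B).
  apply: FOLBox_trans AB; rewrite -{2}(subst_id x A).
  exact: FOLBox_inst (admissible_id x A).
by apply: FOLBox_mp (FOLBox_gen x H) (FOLBox_dist _ _); rewrite /= eqxx.
Qed.

Lemma FOLBox_box_mono A B : FOLBox (Imp A B) -> FOLBox (Imp (Box A) (Box B)).
Proof. by move=> /FOLBox_nec /FOLBox_mp; apply; apply: FOLBox_K. Qed.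

Lemma FOLBox_unbox A :
  FOLBox (Imp A (unbox A)) /\ FOLBox (Imp (unbox A) A).
Proof.
elim: A => /= [n j xs|x y|B [IH1 IH2]|B [IB1 IB2] C [IC1 IC2]|x B [IH1 IH2]|B [IH1 IH2]].
- by split; folbox_taut.
- by split; folbox_taut.
- by split; [apply: (FOLBox_mp IH2)|apply: (FOLBox_mp IH1)]; folbox_taut.
- split; [apply: (FOLBox_mp IB2); apply: (FOLBox_mp IC1)
         |apply: (FOLBox_mp IB1); apply: (FOLBox_mp IC2)]; folbox_taut.
- by split; apply: FOLBox_all_mono.
- case: pselect => [thesis|nonthesis]; split.
  + exact: FOLBox_const (FOLBox_refl 0).
  + apply: FOLBox_const; apply: FOLBox_mp (FOLBox_box_mono IH2).
    exact: FOLBox_nec (FOL_FOLBox thesis).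
  (* [Box B] implies [Box (unbox B)], which the non-thesis axiom refutes. *)
  + have nB := FOLBox_nonthesis (box_free_unbox B) nonthesis.
    apply: (FOLBox_mp nB); apply: (FOLBox_mp (FOLBox_box_mono IH1)); folbox_taut.
  + apply: (FOLBox_mp (FOLBox_refl 0)); folbox_taut.
Qed.

(** * Truth in universal structures *)

Lemma universal_models M A : universal M -> box_free A -> models M A <-> FOL A.
Proof.
move=> uM bA; split=> [mA|fA]; last exact: FOL_sound.
by apply: FOL_complete => // N; apply: uM.
Qed.

Lemma sat_unbox M (v : valuation M) (w : world M) A :
  universal M -> sat v w A <-> sat v w (unbox A).
Proof.
move=> uM; elim: A v w => //= [B IH|B IHB C IHC|x B IH|B IH] v w.
- by have := IH v w; tauto.
- by have := IHB v w; have := IHC v w; tauto.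
- by split=> H a; apply/IH.
(* By induction at all points, [Box B] holds iff [unbox B] is valid in M, which universality turns
   into being a thesis. *)
- have E : (forall v' (w' : world M), sat v' w' B) <-> FOL (unbox B).
    apply: iff_trans (universal_models uM (box_free_unbox B)).
    by split=> H v' w'; apply/IH.
  by case: pselect => F /=; tauto.
Qed.

Theorem theorem4 (A : form) :
  (exists (M : structure) (v : valuation M) (w : world M),
     universal M /\ sat v w (Box A)) ->
  FOLBox A.
Proof.
case=> M [v0 [w0 [uM satA]]].
have /(universal_models uM (box_free_unbox A)) thesis : models M (unbox A).
  by move=> v w; apply: (sat_unbox v w A uM).1; apply: satA.
exact: FOLBox_mp (FOL_FOLBox thesis) (FOLBox_unbox A).2.
Qed.
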